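(* Let $b,c>1$ and $\ell\in\mathbb{N}$, and let $\varphi(n)=c^{b^n}$ for $n\in\mathbb{N}$. Let \[ \mathcal{E}''_{\ell}(\varphi):=\{x\in[0,1]: a_n'(x)\cdots a_{n+\ell-1}'(x)\geq\varphi(n)\text{ for all } n\in\mathbb{N}\}, \] \[ \mathcal{E}'_{\ell}(\varphi):=\{x\in[0,1): a_n'(x)\cdots a_{n+\ell-1}'(x)\geq\varphi(n)\text{ for infinitely many } n\in\mathbb{N}\}. \] Then \[ \dim_H\mathcal{E}''_{\ell}(\varphi)=\dim_H\mathcal{E}'_{\ell}(\varphi)=\frac{1}{b+1}. \]
   Context: For irrational $x\in(0,1)$ with continued fraction expansion $x=[a_1(x),a_2(x),\dots]$, the $a_n(x)\in\mathbb{N}$ are its partial quotients. Define $a_n'(x)=a_n(x)$ if $a_n(x)$ is prime, and $a_n'(x)=0$ otherwise. $\dim_H$ denotes Hausdorff dimension. *)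

(* Defs.v *)
From HB Require Import structures.
From mathcomp Require Import all_boot all_order all_algebra.
From mathcomp Require Import all_classical all_reals all_analysis.
Set Implicit Arguments. Unset Strict Implicit. Unset Printing Implicit Defensive.
Import Order.TTheory GRing.Theory Num.Theory.
Local Open Scope classical_set_scope.
Local Open Scope ring_scope.

Section Defs.
Variable R : realType.

Definition gauss (x : R) : R := x^-1 - (Num.truncn x^-1)%:R.

(** [pq n x] = a_n(x) for n >= 1 (a_1(x) = floor(1/x)); index 0 is junk. *)
Definition pq (n : nat) (x : R) : nat := Num.truncn ((iter n.-1 gauss x)^-1).

Definition pq' (n : nat) (x : R) : nat := if prime (pq n x) then pq n x else 0.

Definition irrational (x : R) : Prop := ~ exists q : rat, x = ratr q.

Definition diam (A : set R) : \bar R :=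
  ereal_sup ([set 0%E] `|` [set (`|x - y|)%:E | x in A & y in A]).

Definition diam_pow (s : R) (A : set R) : \bar R :=
  if A == set0 then 0%E else ((fine (diam A)) `^ s)%:E.

Definition hcontent (s delta : R) (E : set R) : \bar R :=
  ereal_inf [set (\sum_(i <oo) diam_pow s (U i))%E | U in
    [set U : nat -> set R | E `<=` \bigcup_i U i /\
                            forall i, (diam (U i) <= delta%:E)%E]].

(** s-dimensional Hausdorff measure: lim_{delta -> 0} = sup_{delta > 0}. *)
Definition hmeasure (s : R) (E : set R) : \bar R :=
  ereal_sup [set hcontent s delta E | delta in [set d : R | 0 < d]].

Definition dimH (E : set R) : \bar R :=
  ereal_inf [set s%:E | s in [set s : R | 0 <= s /\ hmeasure s E = 0%E]].

Definition prodq (l n : nat) (x : R) : R := \prod_(n <= i < n + l) (pq' i x)%:R.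

Definition phi (b c : R) (n : nat) : R := c `^ (b ^+ n).

Definition Ell2 (b c : R) (l : nat) : set R :=
  [set x | 0 <= x <= 1 /\ irrational x /\
           forall n : nat, (0 < n)%N -> phi b c n <= prodq l n x].

Definition Ell1 (b c : R) (l : nat) : set R :=
  [set x | 0 <= x < 1 /\ irrational x /\
           forall N : nat, exists n : nat, (N < n)%N /\ phi b c n <= prodq l n x].
End Defs.

(* Main.v *)
Require Import Defs.
From HB Require Import structures.
From mathcomp Require Import all_boot all_order all_algebra.
From mathcomp Require Import all_classical all_reals all_analysis.
From mathcomp Require Import zify ring lra.
Import Order.TTheory GRing.Theory Num.Theory.
Import numFieldNormedType.Exports.
Local Open Scope classical_set_scope.
Local Open Scope ring_scope.

(** Lower bound: partial quotients ranging over the first [M_n] primes above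
    [M_n ~ phi n] lie below [M_n ^ (1 + e)] by Chebyshev's estimate.  Sending the
    mixed radix digits of [y] in [0, 1) (radices [M_n]) to these primes gives a map
    [h] into the set with [|y - y'| <= C |h y - h y'| ^ s] for every
    [s < 1 / (b + 1)], so Lebesgue measure bounds the [s]-dimensional Hausdorff
    measure from below.

    Upper bound: let [P_m] be the product of the first [m] partial quotients.  For
    [beta < b], infinitely many [m] satisfy
    [P_(m+1) >= max (P_m, exp (beta ^ m)) ^ beta].  A cylinder of order [m] cut down
    by this condition has diameter at most
    [P_m^-1 * max (P_m, exp (beta ^ m)) ^ (- beta)], and when [s (beta + 1) > 1] the
    [s]-th powers of these diameters sum to at most [Z ^ m * exp (- tau beta ^ m)]
    over the cylinders of order [m]. *)

Set Implicit Arguments.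
Unset Strict Implicit.
Unset Printing Implicit Defensive.

(* The library's [irrational] is a different constant. *)
Local Notation irrational := Defs.irrational.

(** * Chebyshev's lower bound for the number of primes *)

(** By Legendre's formula the exponent of [p] is a sum over [k] of floor(2m / p^k) - 2 floor(m /
    p^k). Each term is at most 1 and vanishes once p^k > 2m, so at most log_p (2m) terms count. *)
Lemma pow_logn_central_bin (p m : nat) : prime p -> (0 < m)%N ->
  (p ^ logn p 'C(m.*2, m) <= m.*2)%N.
Proof.
move=> pp m0; have p1 := prime_gt1 pp.
have h2 : (0 < m.*2)%N by rewrite double_gt0.
have E : logn p 'C(m.*2, m) =
    (\sum_(1 <= k < m.*2.+1) (m.*2 %/ p ^ k - (m %/ p ^ k).*2))%N.
  have mm : (m <= m.*2)%N by rewrite -addnn leq_addr.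
  have := congr1 (logn p) (bin_fact mm).
  have -> : (m.*2 - m = m)%N by rewrite -addnn addnK.
  rewrite !lognM ?muln_gt0 ?fact_gt0 ?bin_gt0 //.
  rewrite (logn_fact m pp) (logn_fact m.*2 pp).
  (* The Legendre sum for [m] is padded with zero terms so that both sums run over the same
     range. *)
  have -> : (\sum_(1 <= k < m.+1) m %/ p ^ k = \sum_(1 <= k < m.*2.+1) m %/ p ^ k)%N.
    rewrite [RHS](big_cat_nat (n := m.+1)) //=.
    rewrite [X in (_ + X)%N]big1_seq ?addn0 // => k.
    rewrite mem_index_iota => /and3P[_ mk _].
    by rewrite divn_small // (leq_trans mk) // ltnW // ltn_expl.
  move=> H.
  rewrite sumnB => [|k _]; last first.
    by rewrite leq_divRL ?expn_gt0 ?prime_gt0 // -doubleMl leq_double leq_trunc_div.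
  rewrite -H; set S := (\sum_(_ <= _ < _) _)%N in H *.
  set S' := (\sum_(_ <= _ < _) _)%N.
  suff -> : S' = (S + S)%N by rewrite addnK.
  by rewrite -big_split; apply: eq_bigr => k _; rewrite -addnn.
have p0 : (0 < p)%N by apply: ltnW.
apply: (@leq_trans (p ^ trunc_log p m.*2)); last exact: trunc_logP.
rewrite leq_exp2l // E.
have tl : (trunc_log p m.*2 < m.*2.+1)%N.
  by rewrite ltnS (leq_trans (ltnW (ltn_expl _ p1))) // trunc_logP.
rewrite (big_cat_nat (n := (trunc_log p m.*2).+1)) //=.
rewrite [X in (_ + X)%N]big1_seq ?addn0 => [|k]; last first.
  rewrite mem_index_iota => /and3P[_ kl _].
  rewrite (@divn_small m.*2) ?sub0n // (leq_trans (trunc_log_ltn _ p1)) //.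
  by rewrite leq_exp2l.
apply: (@leq_trans (\sum_(1 <= k < (trunc_log p m.*2).+1) 1)%N).
  apply: leq_sum => k _.
  have pk : (0 < p ^ k)%N by rewrite expn_gt0 p0.
  move: (p ^ k)%N pk => q q0.
  rewrite leq_subLR addn1 -ltnS ltn_divLR // -!muln2.
  have := ltn_ceil m q0; nia.
by rewrite sum_nat_const_nat muln1 subn1.
Qed.

(** In the prime factorization, every prime power is at most 2m by [pow_logn_central_bin], and a
    prime above 2m cannot occur for the same reason. *)
Lemma central_bin_le (m : nat) : (0 < m)%N ->
  ('C(m.*2, m) <= m.*2 ^ count prime (iota 0 m.*2.+1))%N.
Proof.
move=> m0.
have C0 : (0 < 'C(m.*2, m))%N by rewrite bin_gt0 -addnn leq_addr.
rewrite -{1}(partnT C0) (widen_partn _ (leq_maxl 'C(m.*2, m) m.*2)).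
set N := count _ _; rewrite (big_cat_nat (n := m.*2.+1)) //= ?ltnS ?leq_maxr //.
rewrite [X in (_ * X)%N]big1_seq ?muln1 => [|p]; last first.
  rewrite mem_index_iota => /and3P[_ mp _].
  have [pp|/negbTE np] := boolP (prime p); last by rewrite lognE np.
  have := pow_logn_central_bin pp m0.
  case: (logn _ _) => // k; rewrite leqNgt (leq_trans mp) //.
  by rewrite expnS leq_pmulr // expn_gt0 prime_gt0.
rewrite /N -iter_muln_1 -big_const_seq /index_iota subn0 [leqRHS]big_mkcond.
rewrite [leqLHS]big_mkcond.
apply: (big_ind2 (fun x y => (x <= y)%N)) => [//|*|p _]; first exact: leq_mul.
have [pp|/negbTE np] := boolP (prime p); last by rewrite lognE np.
exact: pow_logn_central_bin.
Qed.

Lemma expn2_le_central_bin (m : nat) : (2 ^ m <= 'C(m.*2, m))%N.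
Proof.
elim: m => // m IH.
rewrite doubleS binS expnS mul2n -addnn; apply: leq_add.
  by apply: leq_trans IH _; rewrite binS leq_addl.
by apply: leq_trans IH _; apply: leq_bin2l.
Qed.

(** With k = 4j + 16 and m = Mk, the two bounds on the central binomial give 2^m <= (2m)^pi(2m). It
    remains to see (2m)^(2M) < 2^m = (2^k)^M, and indeed 2m <= 2k 2^j <= 2^(2j+7) while 2^k =
    (2^(2j+8))^2. *)
Lemma count_prime_ge (M j : nat) : (0 < M)%N -> (M <= 2 ^ j)%N ->
  (M.*2 < count prime (iota 0 (M * (4 * j + 16)).*2.+1))%N.
Proof.
move=> M0 Mj; set k := (4 * j + 16)%N; set m := (M * k)%N.
have k0 : (0 < k)%N by rewrite /k addn_gt0 orbT.
have m0 : (0 < m)%N by rewrite muln_gt0 M0 k0.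
have H := leq_trans (expn2_le_central_bin m) (central_bin_le m0).
have m1 : (1 < m.*2)%N by rewrite -addnn; lia.
rewrite -(ltn_exp2l _ _ m1); apply: leq_trans H.
have E : (m.*2 ^ M.*2 = (m.*2 ^ 2) ^ M)%N by rewrite -expnM mul2n.
rewrite E /m (mulnC M k) expnM ltn_exp2r //.
have : (k.*2 * 2 ^ j <= 2 ^ (2 * j + 7))%N.
  rewrite /k; elim: j {Mj m m0 m1 E k k0} => // j.
  have -> : (2 * j.+1 + 7 = (2 * j + 7).+2)%N by lia.
  rewrite !expnS -!muln2; move: (2 ^ j)%N (2 ^ (2 * j + 7))%N => Y X; nia.
have -> : (2 ^ k = 2 ^ (2 * j + 8) * 2 ^ (2 * j + 8))%N.
  by rewrite -expnD /k; congr (_ ^ _)%N; lia.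
have -> : (2 ^ (2 * j + 8) = 2 * 2 ^ (2 * j + 7))%N by rewrite -expnS; congr (_ ^ _)%N; lia.
have : (0 < 2 ^ (2 * j + 7))%N by rewrite expn_gt0.
move: (2 ^ (2 * j + 7))%N (2 ^ j)%N Mj => X Y MY X0 XY.
have : (k.*2 * M <= X)%N by apply: leq_trans XY; rewrite leq_mul2l MY orbT.
rewrite -doubleMl; move: (k * M)%N => Z; rewrite -muln2 => ZX.
nia.
Qed.

(** Of the more than 2M primes counted by [count_prime_ge], at most M lie below [M]. The remaining
    ones are odd because 2 < M, so consecutive ones differ by at least 2; this factor 2 later
    absorbs the loss of 1 in [cflim_first_diff]. *)
Lemma prime_block (M j : nat) : (2 < M)%N -> (M <= 2 ^ j)%N ->
  exists f : nat -> nat,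
    (forall d, (d < M)%N -> prime (f d) /\ (M <= f d <= (M * (4 * j + 16)).*2)%N) /\
    (forall d d', (d < d' < M)%N -> (f d + 2 * (d' - d) <= f d')%N).
Proof.
move=> M2 Mj; have M0 : (0 < M)%N by apply: ltn_trans M2.
set B := (M * (4 * j + 16)).*2.
set r := [seq p <- iota M (B.+1 - M) | prime p].
have MB : (M <= B.+1)%N by rewrite /B -muln2; nia.
have sr : (M <= size r)%N.
  have := count_prime_ge M0 Mj; rewrite -/B -(subnKC MB) iotaD count_cat.
  rewrite size_filter add0n => H.
  have := count_size prime (iota 0 M); rewrite size_iota => H'.
  rewrite -(leq_add2l M) addnn; apply: leq_trans (leq_trans (ltnW H) _) => //.
  by rewrite leq_add2r.
have rP p : p \in r -> prime p /\ (M <= p <= B)%N.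
  rewrite mem_filter mem_iota subnKC // ltnS => /andP[]; by [].
have rs : sorted ltn r by apply: sorted_filter; [exact: ltn_trans|exact: iota_ltn_sorted].
exists (nth 0%N r); split.
  by move=> d dM; apply: rP; apply: mem_nth; apply: leq_trans sr.
have step d : (d.+1 < M)%N -> (nth 0 r d + 2 <= nth 0 r d.+1)%N.
  move=> dM.
  have d1 : (d.+1 < size r)%N by apply: leq_trans sr.
  have lt : (nth 0 r d < nth 0 r d.+1)%N.
    by apply: (sorted_ltn_nth ltn_trans) => //; rewrite inE // ltnW.
  have [p1 /andP[b1 _]] := rP _ (mem_nth 0%N (ltnW d1)).
  have [p2 /andP[b2 _]] := rP _ (mem_nth 0%N d1).
  have o1 : odd (nth 0%N r d) by case: (even_prime p1) => // e; move: b1; rewrite e leqNgt M2.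
  have o2 : odd (nth 0%N r d.+1) by case: (even_prime p2) => // e; move: b2; rewrite e leqNgt M2.
  move: o1 o2 lt; lia.
move=> d d' /andP[dd' d'M].
elim: d' dd' d'M => // d' IH; rewrite ltnS leq_eqVlt => /predU1P[<-|dd'] d'M.
  by rewrite subSnn step.
have := IH dd' (ltnW d'M); have := step d' d'M; lia.
Qed.

(** * Continued fractions *)

Section continued_fractions.
Variable R : realType.
Implicit Types x y : R.

Lemma pqS n x : pq n.+2 x = pq n.+1 (gauss x).
Proof. by rewrite /pq /= -iterSr. Qed.

Lemma gauss_def x : x != 0 -> x = ((pq 1 x)%:R + gauss x)^-1.
Proof. by move=> x0; rewrite /pq /gauss /= addrC subrK invrK. Qed.

Lemma irrational_gauss x : irrational x -> irrational (gauss x).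
Proof.
rewrite /irrational => ix [q qE]; apply: ix; exists ((q + (pq 1 x)%:R)^-1).
rewrite fmorphV rmorphD /= rmorph_nat -qE addrC.
by rewrite /pq /gauss /= addrC subrK invrK.
Qed.

Lemma irrational_neq0 x : irrational x -> x != 0.
Proof. by rewrite /irrational => ix; apply/eqP => x0; apply: ix; exists 0; rewrite rmorph0. Qed.

Lemma gauss_itv x : 0 < x < 1 -> 0 <= gauss x < 1.
Proof.
move=> /andP[x0 x1]; have xV : 0 <= x^-1 by rewrite invr_ge0 ltW.
have /andP[h1 h2] := Num.Theory.truncn_itv xV.
by rewrite /gauss subr_ge0 h1 ltrBlDr -natr1 addrC in h2 *; rewrite h2.
Qed.

Lemma irrational_gauss_itv x : irrational x -> 0 < x < 1 -> 0 < gauss x < 1.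
Proof.
move=> ix /gauss_itv /andP[g0 ->]; rewrite lt_neqAle g0 eq_sym.
by rewrite (irrational_neq0 (irrational_gauss ix)).
Qed.

Lemma pq1_gt0 x : 0 < x < 1 -> (0 < pq 1 x)%N.
Proof.
move=> /andP[x0 x1]; rewrite /pq /= truncn_gt0.
by rewrite invr_ge1 ?ltW // unitf_gt0.
Qed.

Lemma iter_gauss_itv x n : irrational x -> 0 < x < 1 ->
  irrational (iter n (@gauss R) x) /\ 0 < iter n (@gauss R) x < 1.
Proof.
move=> ix x01; elim: n => //= n [ig g01]; split; first exact: irrational_gauss.
exact: irrational_gauss_itv.
Qed.

Lemma pq_gt0 x n : irrational x -> 0 < x < 1 -> (0 < pq n.+1 x)%N.
Proof. by move=> ix x01; case: (iter_gauss_itv n ix x01) => _ /pq1_gt0. Qed.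

Lemma le_invD (a g : R) : 0 < a -> 0 <= g -> (a + g)^-1 <= a^-1.
Proof. by move=> a0 g0; rewrite lef_pV2 ?posrE ?ltr_wpDr // lerDl. Qed.

Lemma le_inv_pq1 x : 0 < x < 1 -> x <= (pq 1 x)%:R^-1.
Proof.
move=> x01; have /andP[x0 x1] := x01.
rewrite {1}(gauss_def (lt0r_neq0 x0)); apply: le_invD.
  by rewrite ltr0n pq1_gt0.
by case/andP: (gauss_itv x01).
Qed.

Lemma dist_invD (a g g' : R) : 0 < a -> 0 <= g -> 0 <= g' ->
  `|(a + g)^-1 - (a + g')^-1| = `|g - g'| * (a + g)^-1 * (a + g')^-1.
Proof.
move=> a0 g0 g'0.
have h : 0 < a + g by rewrite ltr_wpDr.
have h' : 0 < a + g' by rewrite ltr_wpDr.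
have -> : (a + g)^-1 - (a + g')^-1 = (g' - g) * (a + g)^-1 * (a + g')^-1.
  by field; rewrite !lt0r_neq0.
by rewrite !normrM distrC !normfV (gtr0_norm h) (gtr0_norm h').
Qed.

(** Each digit d corresponds to an inverse branch g -> 1 / (d + g) of the Gauss map, which contracts
    by d^-2; the remaining tails both lie in (0, r]. *)
Lemma dist_same_digits (w : seq nat) x y (r : R) :
  irrational x -> 0 < x < 1 -> irrational y -> 0 < y < 1 ->
  (forall i, (i < size w)%N -> pq i.+1 x = (nth 0%N w i).+1) ->
  (forall i, (i < size w)%N -> pq i.+1 y = (nth 0%N w i).+1) ->
  iter (size w) (@gauss R) x <= r -> iter (size w) (@gauss R) y <= r ->
  `|x - y| <= r * \prod_(a <- w) (a.+1%:R ^- 2).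
Proof.
elim: w x y => [|a w IH] x y ix x01 iy y01 wx wy rx ry.
  rewrite big_nil mulr1; move: x01 y01 rx ry => /= /andP[x0 _] /andP[y0 _] rx ry.
  by rewrite ler_norml; apply/andP; split; lra.
have ax : pq 1 x = a.+1 by rewrite wx.
have ay : pq 1 y = a.+1 by rewrite wy.
have gx := irrational_gauss_itv ix x01.
have gy := irrational_gauss_itv iy y01.
have /andP[gx0 _] := gx; have /andP[gy0 _] := gy.
have a0 : 0 < a.+1%:R :> R by rewrite ltr0n.
rewrite (gauss_def (irrational_neq0 ix)) (gauss_def (irrational_neq0 iy)) ax ay.
rewrite (dist_invD a0 (ltW gx0) (ltW gy0)) big_cons.
have : `|gauss x - gauss y| <= r * \prod_(a <- w) (a.+1%:R ^- 2).
  apply: IH => //; try exact: irrational_gauss.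
  - by move=> i iw; rewrite -pqS; apply: wx.
  - by move=> i iw; rewrite -pqS; apply: wy.
  - by rewrite -iterSr.
  - by rewrite -iterSr.
move=> H.
rewrite mulrCA [leRHS]mulrC -[leLHS]mulrA expr2 invfM.
apply: ler_pM => //; first by rewrite mulr_ge0 // invr_ge0 addr_ge0 // ltW.
have ag (g : R) : 0 < g -> 0 <= (a.+1%:R + g)^-1 <= a.+1%:R^-1.
  by move=> g0; rewrite invr_ge0 addr_ge0 ?(ltW g0) // le_invD // ltW.
have /andP[? ?] := ag _ gx0; have /andP[? ?] := ag _ gy0.
exact: ler_pM.
Qed.

(* A rational number would give an infinite descent on denominators. *)
Lemma irrational_of_orbit x : (forall n, 0 < iter n (@gauss R) x < 1) -> irrational x.
Proof.
move=> orb.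
suff H : forall q p : nat, forall y : R, (forall n, 0 < iter n (@gauss R) y < 1) ->
    y * q%:R = p%:R -> q = 0%N.
  case=> r xr; have /andP[x0 _] := orb 0%N.
  suff : `|denq r|%N = 0%N by move/eqP; rewrite absz_eq0 denq_eq0.
  apply: (H _ `|numq r|%N x orb).
  have r0 : 0 <= r by move: x0; rewrite /= xr ltr0q => /ltW.
  have n0 : 0 <= numq r by rewrite numq_ge0.
  have -> : `|denq r|%:R = (denq r)%:~R :> R.
    by rewrite -[in RHS](gez0_abs (denq_ge0 r)).
  have -> : `|numq r|%:R = (numq r)%:~R :> R by rewrite -[in RHS](gez0_abs n0).
  rewrite xr /ratr -mulrA mulVf ?mulr1 // intr_eq0; exact: denq_neq0.
move=> {x orb} q; have [n] := ubnP q; elim: n q => // n IH q qn p y orb yq.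
have /andP[y0 y1] := orb 0%N; rewrite /= in y0 y1.
case: (posnP q) => // q0.
have q0' : 0 < q%:R :> R by rewrite ltr0n.
have p0 : (0 < p)%N by rewrite -(ltr0n R) -yq mulr_gt0.
have pq : (p < q)%N by rewrite -(ltr_nat R) -yq gtr_pMl.
have /andP[g0 _] := orb 1%N; rewrite /= in g0.
have p0' : 0 < p%:R :> R by rewrite ltr0n.
have gE : gauss y * p%:R = q%:R - (Num.truncn y^-1)%:R * p%:R.
  by rewrite /gauss mulrBl -yq mulrA mulVf ?mul1r // lt0r_neq0.
have le : (Num.truncn y^-1 * p <= q)%N.
  by rewrite -(ler_nat R) natrM -subr_ge0 -gE mulr_ge0 // ltW.
have : p = 0%N.
  apply: (IH p _ (q - Num.truncn y^-1 * p)%N (gauss y)).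
  - by rewrite (leq_trans pq).
  - by move=> k; rewrite -iterSr.
  - by rewrite gE natrB // natrM.
by move=> pE; rewrite pE in p0.
Qed.

(** Convergents of a continued fraction with quotients indexed from 0: [a i] plays the role of the
    partial quotient of index i + 1. *)
Fixpoint cf (n : nat) (a : nat -> nat) : R :=
  if n is n'.+1 then ((a 0)%:R + cf n' (fun i => a i.+1))^-1 else 0.

Lemma cf_itv n (a : nat -> nat) : (forall i, (2 <= a i)%N) -> 0 <= cf n a <= 1.
Proof.
elim: n a => [|n IH] a ha /=; first by rewrite lexx ler01.
have /andP[c0 _] := IH (fun i => a i.+1) (fun i => ha i.+1).
have a1 : 1 <= (a 0)%:R :> R by rewrite ler1n (leq_trans _ (ha 0%N)).
rewrite invr_ge0 addr_ge0 //=; rewrite invf_le1; lra.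
Qed.

(** Since the quotients are at least 2, as all primes are, each branch g -> 1 / (a + g) contracts by
    at least 1/2. *)
Lemma cf_cauchy n k (a : nat -> nat) : (forall i, (2 <= a i)%N) ->
  `|cf n a - cf (n + k) a| <= 2^-1 ^+ n.
Proof.
elim: n a => [|n IH] a ha.
  have := cf_itv k ha; rewrite add0n expr0 /= sub0r normrN => /andP[h1 h2].
  by rewrite ger0_norm.
have ha' i := ha i.+1.
have := IH _ ha'; have := cf_itv n ha'; have := cf_itv (n + k) ha'.
rewrite addSn /=; set u := cf n _; set v := cf _ _ => /andP[v0 _] /andP[u0 _] H.
have a2 : 2 <= (a 0)%:R :> R by rewrite ler_nat.
rewrite dist_invD //; last lra.
rewrite exprSr -mulrA; apply: ler_pM => //.
  by rewrite mulr_ge0 // invr_ge0 addr_ge0.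
rewrite -[leRHS]mulr1; apply: ler_pM; rewrite ?invr_ge0 ?addr_ge0 //.
  by rewrite lef_pV2 ?posrE; lra.
rewrite invf_le1; lra.
Qed.

Definition cflim (a : nat -> nat) : R := limn (fun n => cf n a).

Lemma is_cvg_cf (a : nat -> nat) : (forall i, (2 <= a i)%N) -> cvgn (fun n => cf n a).
Proof.
move=> ha; apply/cauchy_cvgP/cauchy_exP => e e0.
have [n _ nP] := near_infty_natSinv_expn_lt (PosNum e0).
exists (cf n a); exists n => // m /= nm; rewrite -ball_normE /=.
rewrite -(subnKC nm); apply: le_lt_trans (cf_cauchy _ _ ha) _.
by have := nP n (leqnn n); rewrite /= div1r exprVn.
Qed.

Lemma cflimS (a : nat -> nat) : (forall i, (2 <= a i)%N) ->
  cflim a = ((a 0)%:R + cflim (fun i => a i.+1))^-1.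
Proof.
move=> ha; have ha' i := ha i.+1.
have l0 : 0 <= cflim (fun i => a i.+1).
  apply: limr_ge; first exact: is_cvg_cf.
  by near=> n; case/andP: (cf_itv n ha').
have a0 : 0 < (a 0)%:R :> R by rewrite ltr0n (leq_trans _ (ha 0%N)).
apply/cvg_lim => //; rewrite -(cvg_shiftS (fun n => cf n a)) /=.
apply: cvgV; first by rewrite lt0r_neq0 // ltr_wpDr.
by apply: cvgD; [exact: cvg_cst|exact: is_cvg_cf].
Unshelve. all: by end_near. Qed.

Lemma cflim_itv (a : nat -> nat) : (forall i, (2 <= a i)%N) -> 0 < cflim a < 1.
Proof.
move=> ha.
have l0 (a' : nat -> nat) : (forall i, (2 <= a' i)%N) -> 0 <= cflim a'.
  move=> ha'; apply: limr_ge; first exact: is_cvg_cf.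
  by near=> n; case/andP: (cf_itv n ha').
have := l0 _ (fun i => ha i.+1); set l := cflim _ => hl.
have a0 : 2 <= (a 0)%:R :> R by rewrite ler_nat.
rewrite cflimS // -/l; have h : 1 < (a 0)%:R + l by lra.
have h0 : 0 < (a 0)%:R + l by lra.
by rewrite invr_gt0 h0 invf_lt1.
Unshelve. all: by end_near. Qed.

(** The tail lies strictly between 0 and 1, so [a 0] is exactly the integer part of the inverse. *)
Lemma gauss_cflim (a : nat -> nat) : (forall i, (2 <= a i)%N) ->
  gauss (cflim a) = cflim (fun i => a i.+1) /\ pq 1 (cflim a) = a 0%N.
Proof.
move=> ha; have /andP[h0 h1] := cflim_itv (fun i => ha i.+1).
have E : Num.truncn (cflim a)^-1 = a 0%N.
  rewrite cflimS // invrK; apply: truncn_def.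
  by rewrite lerDl ltW //= -natr1 ltrD2l.
by rewrite /gauss /pq /= E cflimS // invrK addrC addKr.
Qed.

Lemma iter_gauss_cflim (a : nat -> nat) n : (forall i, (2 <= a i)%N) ->
  iter n (@gauss R) (cflim a) = cflim (fun i => a (n + i)%N).
Proof.
move=> ha; elim: n => // n IH /=; rewrite IH (gauss_cflim _).1 //.
by congr cflim; apply/funext => i; rewrite addnS.
Qed.

Lemma pq_cflim (a : nat -> nat) n : (forall i, (2 <= a i)%N) ->
  pq n.+1 (cflim a) = a n.
Proof.
move=> ha; have := iter_gauss_cflim n ha.
rewrite {1}/pq /= => ->; have [_] := @gauss_cflim (fun i => a (n + i)%N) (fun i => ha _).
by rewrite {1}/pq /= addn0.
Qed.

Lemma irrational_cflim (a : nat -> nat) : (forall i, (2 <= a i)%N) ->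
  irrational (cflim a).
Proof.
move=> ha; apply: irrational_of_orbit => n; rewrite iter_gauss_cflim //.
by apply: cflim_itv => i; apply: ha.
Qed.

(** At the first different digits p and p', with tails u and v, the distance is |p' + v - p - u| /
    ((p + u) (p' + v)). The tails cost at most 1 in the numerator, and the denominator is at most (B
    + 1)^2. Each common digit before contracts by no more than the same factor. *)
Lemma cflim_first_diff (n : nat) (a a' B : nat -> nat) :
  (forall i, (2 <= a i <= B i)%N) -> (forall i, (2 <= a' i <= B i)%N) ->
  (forall i, (i < n)%N -> a i = a' i) ->
  `|(a n)%:R - (a' n)%:R| - 1 <=
    `|cflim a - cflim a'| * \prod_(i < n.+1) (B i).+1%:R ^+ 2 :> R.
Proof.
elim: n a a' B => [|n IH] a a' B ha ha' eqn.
all: have h i : (2 <= a i)%N by case/andP: (ha i).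
all: have h' i : (2 <= a' i)%N by case/andP: (ha' i).
all: have /andP[u0 u1] := cflim_itv (fun i => h i.+1).
all: have /andP[v0 v1] := cflim_itv (fun i => h' i.+1).
all: have a2 : 2 <= (a 0)%:R :> R by rewrite ler_nat.
all: have a2' : 2 <= (a' 0)%:R :> R by rewrite ler_nat.
all: have aB : (a 0)%:R <= (B 0)%:R :> R by rewrite ler_nat; case/andP: (ha 0%N).
all: have aB' : (a' 0)%:R <= (B 0)%:R :> R by rewrite ler_nat; case/andP: (ha' 0%N).
all: rewrite (cflimS h) (cflimS h').
all: move: u0 u1 v0 v1; set u := cflim _; set v := cflim _ => u0 u1 v0 v1.
- rewrite big_ord1 -natr1.
  move: a2 a2' aB aB'; move: ((a 0)%:R : R) ((a' 0)%:R : R) ((B 0)%:R : R) => p p' b hp hp' pb pb'.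
  have -> : (p + u)^-1 - (p' + v)^-1 = (p' + v - p - u) / ((p + u) * (p' + v)).
    by field; rewrite !lt0r_neq0 //; lra.
  have h0 : 0 < (p + u) * (p' + v) by rewrite mulr_gt0 //; lra.
  rewrite normrM normfV [X in _ / X]gtr0_norm //.
  have h1 : `|p - p'| - 1 <= `|p' + v - p - u|.
    rewrite lerBlDr; have -> : p - p' = (v - u) - (p' + v - p - u) by ring.
    apply: le_trans (ler_normB _ _) _; rewrite addrC lerD2l ler_norml; lra.
  apply: le_trans h1 _; rewrite -mulrA ler_peMr // mulrC.
  rewrite ler_pdivlMr // mul1r expr2; apply: ler_pM; lra.
- rewrite -(eqn 0%N) //.
  have a0 : 0 < (a 0)%:R :> R by lra.
  rewrite (dist_invD a0 (ltW u0) (ltW v0)).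
  have := IH (fun i => a i.+1) (fun i => a' i.+1) (fun i => B i.+1)
    (fun i => ha i.+1) (fun i => ha' i.+1) (fun i hi => eqn i.+1 hi).
  rewrite -/u -/v [X in _ -> _ <= _ * X]big_ord_recl.
  under [X in _ -> _ <= _ * (_ * X)]eq_bigr do rewrite lift0.
  set P := \prod_(_ < _) _ => H; apply: le_trans H _.
  rewrite mulrA ler_wpM2r //.
    by apply: prodr_ge0 => i _; rewrite exprn_ge0 ?ler0n.
  rewrite -!mulrA ler_peMr // mulrA -invfM.
  rewrite -natr1; move: a2 aB; move: ((a 0)%:R : R) ((B 0)%:R : R) => p b hp pb.
  have h0 : 0 < (p + u) * (p + v) by rewrite mulr_gt0 //; lra.
  rewrite mulrC ler_pdivlMr // mul1r expr2; apply: ler_pM; lra.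
Qed.

End continued_fractions.

(** * Hausdorff measure and dimension *)

Section hausdorff.
Variable R : realType.
Implicit Types (A E : set R) (s : R).

Lemma diam_ge0 A : (0 <= diam A)%E.
Proof. by apply: ereal_sup_ubound; left. Qed.

Lemma diam_pow_ge0 s A : (0 <= diam_pow s A)%E.
Proof. by rewrite /diam_pow; case: ifP => // _; rewrite lee_fin powR_ge0. Qed.

Lemma dist_le_diam A x y : A x -> A y -> (`|x - y|%:E <= diam A)%E.
Proof. by move=> Ax Ay; apply: ereal_sup_ubound; right; exists x => //; exists y. Qed.

Lemma diam_le A (r : R) : 0 <= r ->
  (forall x y, A x -> A y -> `|x - y| <= r) -> (diam A <= r%:E)%E.
Proof.
move=> r0 H; apply: ge_ereal_sup => _ [->|[x Ax [y Ay <-]]]; rewrite lee_fin //.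
exact: H.
Qed.

Lemma diam_pow_le s A (r : R) : 0 <= s -> 0 <= r -> (diam A <= r%:E)%E ->
  (diam_pow s A <= (r `^ s)%:E)%E.
Proof.
move=> s0 r0 dA; rewrite /diam_pow; case: ifP => _.
  by rewrite lee_fin powR_ge0.
have dA0 := diam_ge0 A.
have fA : diam A \is a fin_num by rewrite ge0_fin_numE // (le_lt_trans dA) ?ltry.
rewrite lee_fin ge0_ler_powR ?nnegrE ?fine_ge0 //.
by rewrite -lee_fin fineK.
Qed.

Lemma hcontent_le s (d : R) E E' : E `<=` E' -> (hcontent s d E <= hcontent s d E')%E.
Proof.
move=> EE'; apply: ereal_inf_le_tmp => _ [U [HU dU] <-].
by exists U => //; split => //; apply: subset_trans HU.
Qed.

Lemma hmeasure_le s E E' : E `<=` E' -> (hmeasure s E <= hmeasure s E')%E.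
Proof.
move=> EE'; apply: ge_ereal_sup => _ [d d0 <-].
apply: le_trans (hcontent_le s d EE') _.
by apply: ereal_sup_ubound; exists d.
Qed.

Lemma hcontent_ge0 s d E : (0 <= hcontent s d E)%E.
Proof.
apply: le_ereal_inf_tmp => _ [U _ <-].
by apply: nneseries_ge0 => i _ _; apply: diam_pow_ge0.
Qed.

Lemma hmeasure_ge0 s E : (0 <= hmeasure s E)%E.
Proof.
apply: le_trans (hcontent_ge0 s 1 E) _.
by apply: ereal_sup_ubound; exists 1 => //=.
Qed.

(* The preimages of a cover of [E] cover [0, 1), and Lebesgue measure is
   countably subadditive. *)
Lemma hmeasure_neq0 s E (h : R -> R) (C : R) : 0 <= s -> 0 < C ->
  (forall y, 0 <= y < 1 -> E (h y)) ->
  (forall y y', 0 <= y < 1 -> 0 <= y' < 1 -> `|y - y'| <= C * `|h y - h y'| `^ s) ->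
  hmeasure s E <> 0%E.
Proof.
move=> s0 C0 hE hC; apply/eqP; rewrite gt_eqF //.
apply: (@lt_le_trans _ _ ((2 * C)^-1)%:E); first by rewrite lte_fin invr_gt0 mulr_gt0.
apply: (@le_trans _ _ (hcontent s 1 E)); last first.
  by apply: ereal_sup_ubound; exists 1 => //=.
apply: le_ereal_inf_tmp => _ [U [EU dU] <-].
pose r i : R := C * (fine (diam (U i))) `^ s.
pose A i := [set y : R | 0 <= y < 1 /\ U i (h y)].
(* The preimage of [U i] lies within [r i] of any one of its points. If the preimage is empty,
   [xget] centres the interval at 0, which is harmless for covering. Empty [U i] get the empty
   interval, matching the convention [diam_pow s set0 = 0]. *)
pose I i : set R := if U i == set0 then set0
  else [set` `[xget 0 (A i) - r i, xget 0 (A i) + r i]].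
have r0 i : 0 <= r i by rewrite mulr_ge0 ?powR_ge0 // ltW.
have Im i : measurable (I i) by rewrite /I; case: ifP.
have cov : [set` `[0%R, 1%R[] `<=` \bigcup_i I i.
  move=> y; rewrite /= in_itv /= => y01.
  have [i _ Ui] := EU _ (hE _ y01); exists i => //; rewrite /I.
  case: ifP => [/eqP U0|_]; first by rewrite U0 in Ui.
  have [x01 Ux] : A i (xget 0 (A i)) by apply: (@xgetPex _ _ (A i)); exists y.
  move: x01 Ux; set x := xget _ _ => x01 Ux.
  have fU : diam (U i) \is a fin_num.
    by rewrite ge0_fin_numE ?diam_ge0 // (le_lt_trans (dU i)) ?ltry.
  have : `|y - x| <= r i.
    apply: le_trans (hC _ _ y01 x01) _; rewrite ler_wpM2l ?(ltW C0) //.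
    rewrite ge0_ler_powR ?nnegrE ?fine_ge0 ?diam_ge0 //.
    by rewrite -lee_fin fineK // dist_le_diam.
  by rewrite ler_norml /= in_itv /= => /andP[h1 h2]; apply/andP; split; lra.
have m01 : lebesgue_measure ([set` `[0%R, 1%R[] : set R) = 1%E.
  by rewrite lebesgue_measure_itv /= lte_fin ltr01 oppr0 adde0.
have H : (1 <= \sum_(i <oo) lebesgue_measure (I i))%E.
  by rewrite -m01; apply: measure_sigma_subadditive.
have : (1 <= (2 * C)%:E * \sum_(i <oo) diam_pow s (U i))%E.
  rewrite -nneseriesZl; last by move=> *; apply: diam_pow_ge0.
  apply: le_trans H _; apply: lee_nneseries => // i _.
  rewrite /I /diam_pow; case: ifP => _; first by rewrite measure0 mule0.
  rewrite lebesgue_measure_itv /= lte_fin; case: ifP => _; last first.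
    by rewrite -EFinM lee_fin mulr_ge0 ?powR_ge0 // mulr_ge0 // ltW.
  rewrite -EFinB -EFinM lee_fin -mulrA -/(r i); lra.
move: (\sum_(_ <= _ <oo) _)%E => S; rewrite EFinM.
have c0 : 0 < 2 * C by rewrite mulr_gt0.
case: S => [t| |] /=.
- by rewrite -!EFinM !lee_fin => H'; rewrite -[_^-1]mul1r ler_pdivrMr // mulrC.
- by rewrite leey.
- by rewrite -EFinM mulrNy gtr0_sg // mul1e.
Qed.

End hausdorff.

(** * Mixed radix expansions *)

Section mixed_radix.
Variables (R : realType) (M : nat -> nat).
Implicit Types y : R.

(** For y in [0, 1) this is the fractional part of M_0 ... M_(n-1) y, the remainder after n digits
    of the Cantor series of y. *)
Fixpoint radix_rest (n : nat) (y : R) : R :=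
  if n is n'.+1 then
    (M n')%:R * radix_rest n' y - (Num.truncn ((M n')%:R * radix_rest n' y))%:R
  else y.

Definition radix_digit (n : nat) (y : R) : nat :=
  Num.truncn ((M n)%:R * radix_rest n y).

Lemma radix_rest_itv n y : 0 <= y < 1 -> 0 <= radix_rest n y < 1.
Proof.
move=> y01; elim: n => //= n /andP[r0 r1].
have Mr : 0 <= (M n)%:R * radix_rest n y by rewrite mulr_ge0.
have /andP[h1 h2] := truncn_itv Mr.
by rewrite subr_ge0 h1 /= ltrBlDl natr1.
Qed.

Lemma radix_restS n y : (M n)%:R * radix_rest n y = (radix_digit n y)%:R + radix_rest n.+1 y.
Proof. by rewrite /radix_digit /= addrC subrK. Qed.

Lemma radix_digit_lt n y : (0 < M n)%N -> 0 <= y < 1 -> (radix_digit n y < M n)%N.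
Proof.
move=> M0 y01; have /andP[r0 r1] := radix_rest_itv n y01.
have Mr : 0 <= (M n)%:R * radix_rest n y by rewrite mulr_ge0.
have /andP[h1 _] := truncn_itv Mr.
by rewrite -(ltr_nat R) (le_lt_trans h1) // gtr_pMr ?ltr0n.
Qed.

(** Equal digits cancel in the difference of the remainders, so each step just multiplies that
    difference by the radix. *)
Lemma radix_dist_rest n y y' :
  (forall i, (i < n)%N -> radix_digit i y = radix_digit i y') ->
  `|y - y'| * \prod_(i < n) (M i)%:R = `|radix_rest n y - radix_rest n y'|.
Proof.
elim: n => [|n IH] eqd; first by rewrite big_ord0 mulr1.
have E z : radix_rest n.+1 z = (M n)%:R * radix_rest n z - (radix_digit n z)%:R by [].
rewrite !E eqd // big_ord_recr /= mulrA IH => [|i ni]; last by rewrite eqd // ltnS ltnW.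
rewrite -[X in _ * X](ger0_norm (ler0n R (M n))) -normrM.
by congr `|_|; ring.
Qed.

Lemma radix_dist_le n y y' : 0 <= y < 1 -> 0 <= y' < 1 ->
  (forall i, (i < n)%N -> radix_digit i y = radix_digit i y') ->
  `|y - y'| * \prod_(i < n.+1) (M i)%:R <=
    `|(radix_digit n y)%:R - (radix_digit n y')%:R| + 1.
Proof.
move=> y01 y01' eqd; rewrite big_ord_recr /= mulrA radix_dist_rest //.
rewrite -[X in _ * X](ger0_norm (ler0n R (M n))) -normrM.
have e1 := radix_restS n y; have e2 := radix_restS n y'.
have /andP[] := radix_rest_itv n.+1 y01; have /andP[] := radix_rest_itv n.+1 y01'.
move: (radix_rest n.+1 y) (radix_rest n.+1 y') e1 e2 => u v e1 e2 v0 v1 u0 u1.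
have -> : (radix_rest n y - radix_rest n y') * (M n)%:R =
    ((radix_digit n y)%:R - (radix_digit n y')%:R) + (u - v).
  by transitivity ((M n)%:R * radix_rest n y - (M n)%:R * radix_rest n y');
    [ring|rewrite e1 e2; ring].
apply: le_trans (ler_normD _ _) _; rewrite lerD2l ler_norml; lra.
Qed.

(** If all digits agreed, [radix_dist_rest] would give |y - y'| 2^n < 1 for every n. *)
Lemma radix_first_diff y y' : (forall i, (1 < M i)%N) ->
  0 <= y < 1 -> 0 <= y' < 1 -> y != y' ->
  exists2 n, (forall i, (i < n)%N -> radix_digit i y = radix_digit i y') &
    radix_digit n y != radix_digit n y'.
Proof.
move=> M1 y01 y01' yy'.
have [n nP] : exists n, radix_digit n y != radix_digit n y'.
  apply: contrapT => /forallNP H.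
  have {}H i : radix_digit i y = radix_digit i y' by apply/eqP/negPn/negP/H.
  have d0 : 0 < `|y - y'| by rewrite normr_gt0 subr_eq0.
  have [n _ /(_ n (leqnn n))] := near_infty_natSinv_expn_lt (PosNum d0).
  rewrite /= div1r invf_plt ?posrE ?exprn_gt0 // => Hn.
  have := radix_dist_rest (n := n) (fun i _ => H i).
  have : `|radix_rest n y - radix_rest n y'| < 1.
    have /andP[] := radix_rest_itv n y01; have /andP[] := radix_rest_itv n y01'.
    by move=> ? ? ? ?; rewrite ltr_norml; apply/andP; split; lra.
  move=> lt1 E; rewrite -E in lt1.
  have : `|y - y'| * 2 ^+ n <= `|y - y'| * \prod_(i < n) (M i)%:R.
    rewrite ler_wpM2l //; have -> : 2 ^+ n = \prod_(i < n) 2 :> R.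
      by rewrite prodr_const card_ord.
    by apply: ler_prod => i _; rewrite ler0n /= ler_nat.
  move=> /le_lt_trans /(_ lt1); rewrite ltNge; apply/negP/negPn.
  by rewrite -ler_pdivrMl // mulr1 ltW.
have exn : exists n, radix_digit n y != radix_digit n y' by exists n.
case: (ex_minnP exn) => m mP mmin; exists m => // i im.
by apply/eqP/negPn/negP => /mmin; rewrite leqNgt im.
Qed.

End mixed_radix.

(** * Growth estimates *)

Section growth.
Variable R : realType.

Lemma bernoulli_le (b : R) n : 1 < b -> 1 + n%:R * (b - 1) <= b ^+ n.
Proof.
move=> b1; elim: n => [|n IH]; first by rewrite mul0r addr0 expr0.
rewrite exprS -natr1; have b0 : 0 <= b by lra.
have n0 : 0 <= n%:R * (b - 1) ^+ 2 by rewrite mulr_ge0 ?sqr_ge0.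
have := ler_wpM2l b0 IH; lra.
Qed.

Lemma expr_unbounded (b : R) : 1 < b ->
  forall A : R, exists N, forall n, (N <= n)%N -> A <= b ^+ n.
Proof.
move=> b1 A; have b10 : 0 < b - 1 by lra.
exists (Num.truncn (`|A| / (b - 1))).+1 => n Nn; apply: le_trans (bernoulli_le n b1).
have : `|A| / (b - 1) < n%:R.
  by apply: lt_le_trans (truncnS_gt _) _; rewrite ler_nat.
rewrite ltr_pdivrMr // => h; have := ler_norm A; lra.
Qed.

Lemma bounded_of_eventually_nonincreasing (u : nat -> R) (N : nat) :
  (forall n, 0 <= u n) -> (forall n, (N <= n)%N -> u n.+1 <= u n) ->
  exists2 C, 0 < C & forall n, u n <= C.
Proof.
move=> u0 uN; pose C := 1 + \sum_(i < N.+1) u i.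
have S0 : 0 <= \sum_(i < N.+1) u i by apply: sumr_ge0.
have H n : (n <= N)%N -> u n <= C.
  rewrite -ltnS => nN; rewrite /C (bigD1 (Ordinal nN)) //= addrCA lerDl.
  by rewrite addr_ge0 // sumr_ge0.
exists C; first by rewrite ltr_pwDl.
move=> n; have [/H //|/ltnW /subnKC <-] := leqP n N.
elim: (n - N)%N => [|k IH]; first by rewrite addn0 H.
by rewrite addnS; apply: le_trans IH; apply: uN; rewrite leq_addr.
Qed.

Lemma ln_le_powR (x e : R) : 0 < x -> 0 < e -> ln x <= x `^ e / e.
Proof.
move=> x0 e0; rewrite ler_pdivlMr // mulrC -ln_powR.
have p0 : 0 < x `^ e by rewrite powR_gt0.
by apply/ltW/ln_sublinear.
Qed.

(** This bounds the upper end of a prime block, plus one, by a constant times M^(1+e): the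
    logarithmic factor is absorbed by M^e. *)
Lemma trunc_log_le_powR (e : R) : 0 < e -> exists2 K : R, 1 <= K &
  forall m : nat, (0 < m)%N ->
    (m * (4 * (trunc_log 2 m).+1 + 16)).*2.+1%:R <= K * m%:R `^ (1 + e).
Proof.
move=> e0; have l2 : 0 < ln (2 : R) by rewrite ln_gt0 // ltr1n.
(* The left side is m (8t + 40) + 1 <= m (8t + 41), where t <= m^e / (e ln 2) and m^e >= 1. *)
exists (41 + 8 * (e^-1 / ln 2)).
  by rewrite ler_wpDr ?mulr_ge0 ?invr_ge0 ?(ltW e0) ?(ltW l2) // ler1n.
move=> m m0; set t := trunc_log 2 m.
have m1 : 1 <= m%:R :> R by rewrite ler1n.
have mp : 0 < m%:R :> R by rewrite ltr0n.
have tm : 2 ^+ t <= m%:R :> R by rewrite -natrX ler_nat trunc_logP.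
have tl : t%:R * ln 2 <= ln m%:R :> R.
  by rewrite mulr_natl -lnXn // ler_ln ?posrE ?exprn_gt0.
have t1 : t%:R <= m%:R `^ e * (e^-1 / ln 2).
  rewrite mulrA ler_pdivlMr // (le_trans tl) // ln_le_powR //.
have me : 1 <= m%:R `^ e :> R by have := ler_powR m1 (ltW e0); rewrite powRr0.
have -> : (m * (4 * t.+1 + 16)).*2.+1%:R = m%:R * (8 * t%:R + 40) + 1 :> R.
  rewrite -natr1 -muln2 !natrM natrD natrM -natr1; ring.
rewrite powRD ?powRr1 ?ler0n //; last by rewrite (lt0r_neq0 mp) implybT.
rewrite mulrCA; apply: (@le_trans _ _ (m%:R * (8 * t%:R + 41))); first by lra.
rewrite ler_wpM2l ?ler0n //; move: t1 me.
move: (m%:R `^ e) (e^-1 / ln 2) => X Y; nra.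
Qed.

(** The quotient [u n] of the two sides (without C) is eventually nonincreasing. Using B + 1 <= K
    M^(1+e) and M_(n+1) <= 4 M_n^b, the logarithm of u_(n+1) / u_n is at most 2 s ln K + s (1 + 2e)
    ln 4 - eta ln M_n, which is negative for large n because M_n tends to infinity. *)
Lemma digit_growth (b s : R) (M B : nat -> nat) :
  0 < b -> 0 <= s -> s * (b + 1) < 1 ->
  (forall n, (0 < M n)%N) ->
  (forall n, B n = (M n * (4 * (trunc_log 2 (M n)).+1 + 16)).*2) ->
  (forall n, ln (M n.+1)%:R <= ln 4 + b * ln (M n)%:R :> R) ->
  (forall A : R, exists N, forall n, (N <= n)%N -> A <= ln (M n)%:R) ->
  exists2 C : R, 0 < C & forall n,
    (\prod_(i < n.+1) (B i).+1%:R ^+ 2) `^ s <=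
      C * (\prod_(i < n) (M i)%:R * (M n)%:R `^ s).
Proof.
move=> b0 s0 sb M0 BE Mb Minf.
have M0' n : 0 < (M n)%:R :> R by rewrite ltr0n.
pose W n : R := \prod_(i < n) (M i)%:R.
pose Q n : R := \prod_(i < n.+1) (B i).+1%:R ^+ 2.
have W0 n : 0 < W n by apply: prodr_gt0.
have Q0 n : 0 < Q n by apply: prodr_gt0 => i _; rewrite exprn_gt0 ?ltr0n.
have Ms0 n : 0 < (M n)%:R `^ s by rewrite powR_gt0.
pose u n := Q n `^ s / (W n * (M n)%:R `^ s).
(* Small enough for [eta] to be positive: 2 e s b < 4 e (b + 1) = 1 - s (b + 1). *)
pose e := (1 - s * (b + 1)) / (4 * (b + 1)).
have e0 : 0 < e by rewrite divr_gt0 ?mulr_gt0 //; lra.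
have [K K1 KP] := trunc_log_le_powR e0.
have eb : e * (4 * (b + 1)) = 1 - s * (b + 1) by rewrite divfK // lt0r_neq0 //; lra.
pose eta := 1 - s - s * b * (1 + 2 * e).
have eta0 : 0 < eta.
  have s1 : s < 1 by nra.
  have : s * (e * b) <= e * b by rewrite ger_pMl ?(ltW s1) // mulr_gt0.
  rewrite /eta => h; have : 0 < e * b by rewrite mulr_gt0.
  nra.
have [N NP] := Minf ((2 * s * ln K + s * (1 + 2 * e) * ln 4) / eta).
have step n : (N <= n)%N -> u n.+1 <= u n.
  move=> /NP; rewrite ler_pdivrMr // => Hn.
  pose X : R := (B n.+1).+1%:R.
  have X0 : 0 < X by rewrite ltr0n.
  have -> : u n.+1 = u n * ((X ^+ 2) `^ s * (M n)%:R `^ s / ((M n)%:R * (M n.+1)%:R `^ s)).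
    rewrite /u /Q /W big_ord_recr [in X in _ = X * _]/= [\prod_(i < n.+1) (M i)%:R]big_ord_recr /=.
    rewrite powRM ?ltW ?exprn_gt0 //; last exact: (Q0 n).
    by field; rewrite !lt0r_neq0 ?W0.
  rewrite ger_pMr ?divr_gt0 ?powR_gt0 ?mulr_gt0 //.
  rewrite ler_pdivrMr ?mulr_gt0 // mul1r.
  rewrite -ler_ln ?posrE ?mulr_gt0 ?powR_gt0 ?exprn_gt0 //.
  rewrite !lnM ?posrE ?powR_gt0 ?exprn_gt0 // !ln_powR lnXn //.
  have lX : ln X <= ln K + (1 + e) * ln (M n.+1)%:R.
    have K0 : 0 < K by lra.
    rewrite -ln_powR -lnM ?posrE ?powR_gt0 //.
    by rewrite ler_ln ?posrE ?mulr_gt0 ?powR_gt0 // /X BE KP.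
  move: (Mb n) lX Hn; move: (ln X) (ln (M n)%:R) (ln (M n.+1)%:R) (ln K) (ln 4).
  move=> x p q k f hq hx hp.
  have h1 : s * (1 + 2 * e) * q <= s * (1 + 2 * e) * (f + b * p).
    by rewrite ler_wpM2l // mulr_ge0 //; lra.
  have h2 : s * x <= s * (k + (1 + e) * q) by rewrite ler_wpM2l.
  rewrite /eta in hp; rewrite -mulr_natr; lra.
have u0 n : 0 <= u n by rewrite divr_ge0 ?powR_ge0 // mulr_ge0 ?ltW.
have [C C0 HC] := bounded_of_eventually_nonincreasing u0 step.
by exists C => // n; have := HC n; rewrite /u ler_pdivrMr // mulr_gt0.
Qed.

End growth.

(** * The lower bound *)

Section lower_bound.
Variable R : realType.

Lemma phi_ge1 (b c : R) n : 1 < b -> 1 < c -> 1 <= phi b c n.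
Proof.
move=> b1 c1; rewrite /phi -(powRr0 c) ler_powR ?exprn_ge0 // ?ltW //; lra.
Qed.

Lemma ln_phi (b c : R) n : ln (phi b c n) = b ^+ n * ln c.
Proof. by rewrite /phi ln_powR. Qed.

Lemma natr_dist_gap (f : nat -> nat) (M : nat) :
  (forall d d', (d < d' < M)%N -> (f d + 2 * (d' - d) <= f d')%N) ->
  forall d d', (d < M)%N -> (d' < M)%N ->
    2 * `|d%:R - d'%:R| <= `|(f d)%:R - (f d')%:R| :> R.
Proof.
move=> H.
have lt d d' : (d < d')%N -> (d' < M)%N ->
    2 * `|d%:R - d'%:R| <= `|(f d)%:R - (f d')%:R| :> R.
  move=> dd' d'M; have := H d d'; rewrite dd' d'M => /(_ isT) => h.
  have : (f d)%:R + 2 * (d'%:R - d%:R) <= (f d')%:R :> R.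
    by rewrite -natrB ?(ltnW dd') // -natrM -natrD ler_nat.
  have : d%:R < d'%:R :> R by rewrite ltr_nat.
  move=> h1 h2; rewrite distrC gtr0_norm ?subr_gt0 // distrC.
  apply: le_trans (ler_norm _); lra.
move=> d d' dM d'M; have [dd'|dd'|->] := ltngtP d d'.
- exact: lt.
- by rewrite distrC [leRHS]distrC; apply: lt.
- by rewrite !subrr normr0 mulr0.
Qed.

Lemma le_prodq (x : R) n l : (0 < l)%N ->
  (forall i, (n <= i)%N -> prime (pq i x)) -> (pq n x)%:R <= prodq l n x.
Proof.
case: l => // l _ H; rewrite /prodq big_ltn ?addnS ?ltnS ?leq_addr //.
rewrite {1}/pq' H // ler_peMr //.
rewrite big_nat; apply: (big_ind (fun y : R => 1 <= y)) => // [y z y1 z1|i /andP[ni _]].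
  by rewrite mulr_ege1.
by rewrite /pq' H ?(ltnW ni) // ler1n prime_gt0 // H // ltnW.
Qed.

Lemma hmeasure_Ell2_neq0 (b c s : R) (l : nat) : 1 < b -> 1 < c -> (0 < l)%N ->
  0 <= s -> s * (b + 1) < 1 -> hmeasure s (Ell2 b c l) <> 0%E.
Proof.
move=> b1 c1 l0 s0 sb.
have L0 : 0 < ln c by rewrite ln_gt0.
have b0 : 0 < b by lra.
(* Digits are indexed from 0 and partial quotients from 1, hence [n.+1]. Adding 3 gives both M_n >=
   phi (n + 1) and the bound 2 < M_n required by [prime_block], and still M_n <= 4 phi (n + 1). *)
pose M n := (Num.truncn (phi b c n.+1)).+3.
pose B n := (M n * (4 * (trunc_log 2 (M n)).+1 + 16)).*2.
have phi1 n := phi_ge1 n b1 c1.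
have phi0 n : 0 < phi b c n by apply: lt_le_trans (phi1 n).
have phiM n : phi b c n.+1 <= (M n)%:R.
  apply: ltW; by rewrite (lt_le_trans (truncnS_gt _)) // ler_nat /M ltnS leqW // leqW.
have Mphi n : (M n)%:R <= 4 * phi b c n.+1.
  have /andP[h _] := truncn_itv (ltW (phi0 n.+1)).
  rewrite /M -!natr1; have := phi1 n.+1; lra.
have M0' n : 0 < (M n)%:R :> R by rewrite ltr0n.
have lnMn n : b ^+ n.+1 * ln c <= ln (M n)%:R.
  by rewrite -ln_phi ler_ln ?posrE.
have [//|//|n|A|C C0 HC] := @digit_growth R b s M B b0 s0 sb.
- apply: (@le_trans _ _ (ln (4 * phi b c n.+2))).
    by rewrite ler_ln ?posrE ?mulr_gt0.
  rewrite lnM ?posrE // ln_phi exprS -mulrA lerD2l ler_wpM2l ?(ltW b0) //.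
- have [N NP] := expr_unbounded b1 (A / ln c); exists N => n Nn.
  apply: le_trans (lnMn n); have := NP n.+1 (leqW Nn).
  by rewrite ler_pdivrMr.
have [f fP] := choice (fun n => @prime_block (M n) (trunc_log 2 (M n)).+1 isT
  (ltnW (trunc_log_ltn (M n) (isT : (1 < 2)%N)))).
pose d n (y : R) := radix_digit M n y.
have dM n y : 0 <= y < 1 -> (d n y < M n)%N by apply: radix_digit_lt.
have aP n y : 0 <= y < 1 -> prime (f n (d n y)) /\ (M n <= f n (d n y) <= B n)%N.
  by move=> y01; apply: (fP n).1; apply: dM.
have a2 n y : 0 <= y < 1 -> (2 <= f n (d n y) <= B n)%N.
  by move=> y01; have [/prime_gt1 -> /andP[_ ->]] := aP n y y01.
have a2' y : 0 <= y < 1 -> forall n, (2 <= f n (d n y))%N.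
  by move=> y01 n; case/andP: (a2 n y y01).
pose h (y : R) := cflim R (fun n => f n (d n y)).
apply: (@hmeasure_neq0 R s _ h (2 * C)) => //; first by rewrite mulr_gt0.
  move=> y y01; have y2 := a2' y y01.
  have /andP[h0 h1] := cflim_itv R y2.
  split; first by rewrite !ltW.
  split; first exact: irrational_cflim.
  move=> [//|n] _; apply: le_trans (phiM n) _.
  have pqE i : pq i.+1 (h y) = f i (d i y) by apply: pq_cflim.
  apply: (@le_trans _ _ (pq n.+1 (h y))%:R).
    by rewrite pqE ler_nat; case: (aP n y y01) => _ /andP[].
  apply: le_prodq => // -[//|i] _; rewrite pqE; by case: (aP i y y01).
move=> y y' y01 y01'; have [->|yy'] := eqVneq y y'.
  by rewrite subrr normr0 mulr_ge0 ?powR_ge0 // mulr_ge0 // ltW.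
have M1 i : (1 < M i)%N by [].
have [n eqn neqn] := radix_first_diff M1 y01 y01' yy'.
pose D : R := `|(d n y)%:R - (d n y')%:R|.
have D1 : 1 <= D.
  rewrite /D; have : d n y != d n y' by [].
  move: (d n y) (d n y') => k k'; case: ltngtP => // kk' _.
    by rewrite distrC -natrB ?(ltnW kk') // normr_nat ler1n subn_gt0.
  by rewrite -natrB ?(ltnW kk') // normr_nat ler1n subn_gt0.
have DM : D <= (M n)%:R.
  have e1 : (d n y)%:R < (M n)%:R :> R by rewrite ltr_nat dM.
  have e2 : (d n y')%:R < (M n)%:R :> R by rewrite ltr_nat dM.
  have e3 : 0 <= (d n y)%:R :> R by [].
  have e4 : 0 <= (d n y')%:R :> R by [].
  rewrite /D ler_norml; lra.
(* The prime gaps give at least 2D, and 2D - 1 >= D. *)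
have H1 : D <= `|h y - h y'| * \prod_(i < n.+1) (B i).+1%:R ^+ 2.
  have eqa i : (i < n)%N -> f i (d i y) = f i (d i y') by move=> hi; rewrite /d eqn.
  apply: le_trans (cflim_first_diff R (fun i => a2 i y y01) (fun i => a2 i y' y01') eqa).
  have := natr_dist_gap (fP n).2 (dM n y y01) (dM n y' y01'); rewrite -/D; lra.
have := radix_dist_le y01 y01' eqn; rewrite -/(d n y) -/(d n y') -/D => H2.
pose W : R := \prod_(i < n) (M i)%:R.
have WE : \prod_(i < n.+1) (M i)%:R = W * (M n)%:R by rewrite big_ord_recr.
move: H1 (HC n) H2; rewrite WE -/W.
set Q := \prod_(i < n.+1) _ => H1 H3 H2.
have W0 : 0 < W by apply: prodr_gt0.
have Q0 : 0 < Q by apply: prodr_gt0 => i _; rewrite exprn_gt0 ?ltr0n.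
set X := `|h y - h y'| in H1 *.
have D0 : 0 < D by lra.
have Ds : D `^ s <= X `^ s * Q `^ s.
  rewrite -powRM ?normr_ge0 ?(ltW Q0) // ge0_ler_powR ?nnegrE ?(ltW D0) //.
  by rewrite mulr_ge0 ?(ltW Q0) ?normr_ge0.
have s1 : 0 <= 1 - s by nra.
(* Write 2D = 2 D^s D^(1-s). The first power is bounded by X^s Q^s and then by [digit_growth], the
   second by M_n^(1-s) as D <= M_n; the product is 2 C X^s W M_n. *)
have split_pow (t : R) : 0 < t -> t `^ s * t `^ (1 - s) = t.
  move=> t0; rewrite -powRD ?(lt0r_neq0 t0) ?implybT //.
  by rewrite addrC subrK powRr1 ?ltW.
rewrite -(ler_pM2r (mulr_gt0 W0 (M0' n))); apply: le_trans H2 _.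
apply: (@le_trans _ _ (2 * D)); first by lra.
rewrite -[in leLHS](split_pow _ D0) -[in leRHS](split_pow _ (M0' n)).
apply: (@le_trans _ _ (2 * ((X `^ s * Q `^ s) * (M n)%:R `^ (1 - s)))).
  rewrite ler_wpM2l // ler_pM ?powR_ge0 // ge0_ler_powR ?nnegrE ?(ltW D0) //.
apply: (@le_trans _ _ (2 * ((X `^ s * (C * (W * (M n)%:R `^ s))) * (M n)%:R `^ (1 - s)))).
  by rewrite ler_wpM2l // ler_wpM2r ?powR_ge0 // ler_wpM2l ?powR_ge0.
by rewrite le_eqVlt; apply/orP; left; apply/eqP; ring.
Qed.

End lower_bound.

(** * The upper bound *)

Section word_sums.
Variable R : realType.

(* If the growth condition failed from some index on, [max (p m) (beta ^ m)]
   would grow at most like [beta ^ m]. *)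
Lemma growth_dichotomy (p : nat -> R) (beta b k : R) (l : nat) :
  1 < beta -> beta < b -> 0 < k ->
  (forall N, exists2 n, (N < n)%N & b ^+ n * k <= p (n + l)%N) ->
  forall N, exists2 m, (N <= m)%N & beta * Num.max (p m) (beta ^+ m) <= p m.+1.
Proof.
move=> be1 beb k0 Hp N; apply: contrapT => H.
have be0 : 0 < beta by lra.
pose w m := Num.max (p m) (beta ^+ m).
have ub m : (N <= m)%N -> p m.+1 < beta * w m.
  by move=> Nm; rewrite ltNge; apply/negP => h; apply: H; exists m.
have wS m : (N <= m)%N -> w m.+1 <= beta * w m.
  move=> Nm; rewrite {1}/w ge_max (ltW (ub m Nm)) /= exprS ler_wpM2l ?(ltW be0) //.
  by rewrite le_max lexx orbT.
have wN j : w (N + j)%N <= beta ^+ j * w N.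
  elim: j => [|j IH]; first by rewrite addn0 expr0 mul1r.
  rewrite addnS; apply: le_trans (wS _ (leq_addr _ _)) _.
  by rewrite exprS -mulrA ler_wpM2l // ltW.
have w0 m : 0 < w m by rewrite lt_max exprn_gt0 ?orbT.
have bb : 1 < b / beta by rewrite ltr_pdivlMr // mul1r.
(* The threshold makes b^n k exceed beta^(n+l) w_N, an upper bound for p (n + l) under the negated
   conclusion. *)
have [n0 Hn0] := expr_unbounded bb (w N * beta ^+ l / k + 1).
have [n nN] := Hp (maxn n0 N); move: nN; rewrite gtn_max => /andP[n0n Nn].
have := Hn0 n (ltnW n0n); rewrite expr_div_n => h1 h2.
have h3 : p (n + l)%N <= beta ^+ (n + l) * w N.
  apply: (@le_trans _ _ (w (n + l)%N)); first by rewrite le_max lexx.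
  have -> : (n + l = N + (n + l - N))%N by lia.
  apply: le_trans (wN _) _; rewrite ler_wpM2r ?(ltW (w0 _)) //.
  by rewrite ler_eXn2l //; lia.
have bn : 0 < beta ^+ n by rewrite exprn_gt0.
move: h1; rewrite ler_pdivlMr //; apply/negP; rewrite -ltNge.
rewrite -(ltr_pM2r k0); apply: le_lt_trans (le_trans h2 h3) _.
rewrite exprD mulrDl mul1r mulrDl.
have -> : w N * beta ^+ l / k * beta ^+ n * k = beta ^+ n * beta ^+ l * w N.
  by field; rewrite lt0r_neq0.
by rewrite ltrDl mulr_gt0.
Qed.

(** The term (a + 1)^-(1+t) of the series for zeta(1 + t), in exponential form so that products over
    words become sums of exponents. *)
Definition zeta_term (t : R) (a : nat) : R := expR (- (1 + t) * ln a.+1%:R).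

(** A discrete integral test: with E n = (n + 1)^-t, each term after the first is at most (E n - E
    (n + 1)) / t, and the sum telescopes. The comparison follows from 1 + x <= exp x and ln (1 + x)
    <= x. *)
Lemma zeta_sum_le (t : R) K : 0 < t -> \sum_(0 <= a < K) zeta_term t a <= 1 + t^-1.
Proof.
move=> t0; pose E (n : nat) := expR (- t * ln n.+1%:R).
have E0 n : 0 < E n by apply: expR_gt0.
have z n : t * zeta_term t n.+1 <= E n - E n.+1.
  have n1 : 0 < n.+1%:R :> R by rewrite ltr0n.
  have n2 : 0 < n.+2%:R :> R by rewrite ltr0n.
  have -> : zeta_term t n.+1 = E n.+1 / n.+2%:R.
    have -> : n.+2%:R^-1 = expR (- ln n.+2%:R) :> R by rewrite expRN lnK ?posrE.
    by rewrite /zeta_term /E -expRD; congr expR; ring.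
  have le : ln n.+1%:R - ln n.+2%:R <= - n.+2%:R^-1 :> R.
    rewrite -ln_div ?posrE //.
    have -> : n.+1%:R / n.+2%:R = 1 + (- n.+2%:R^-1) :> R.
      have n20 := lt0r_neq0 n2; apply: (mulIf n20).
      by rewrite divfK // mulrDl mulNr mulVf // mul1r -[n.+2%:R]natr1 addrK.
    by apply: le_ln1Dx; rewrite ltrN2 invf_lt1 // ltr1n.
  have -> : E n = E n.+1 * expR (- t * (ln n.+1%:R - ln n.+2%:R)).
    by rewrite /E -expRD; congr expR; ring.
  have : 1 + t / n.+2%:R <= expR (- t * (ln n.+1%:R - ln n.+2%:R)).
    apply: le_trans (expR_ge1Dx _); rewrite lerD2l mulNr -mulrN ler_wpM2l ?(ltW t0) //.
    by rewrite lerNr.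
  move=> /(ler_wpM2l (ltW (E0 n.+1))).
  by move: (expR _) (n.+2%:R^-1) (E n.+1) => X Y e h; rewrite lerBrDr; lra.
have ti : 0 < t^-1 by rewrite invr_gt0.
suff H n : \sum_(0 <= a < n.+1) zeta_term t a <= 1 + (1 - E n) / t.
  case: K => [|n]; first by rewrite big_geq // addr_ge0 // ltW.
  apply: le_trans (H n) _; rewrite mulrBl mul1r.
  have := mulr_gt0 (E0 n) ti; lra.
elim: n => [|n IH].
  by rewrite big_nat1 /zeta_term /E ln1 !mulr0 expR0 subrr mul0r addr0.
rewrite big_nat_recr //=; apply: le_trans (lerD IH (lexx _)) _.
rewrite -addrA lerD2l -lerBrDl -mulrBl.
rewrite ler_pdivlMr // mulrC; have := z n; lra.
Qed.

Fixpoint words (K m : nat) : seq (seq nat) :=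
  if m is m'.+1 then [seq a :: w | a <- index_iota 0 K, w <- words K m'] else [:: [::]].

Lemma mem_words K (w : seq nat) : all (fun a => (a < K)%N) w -> w \in words K (size w).
Proof.
elim: w => [|a w IH] //= /andP[aK wK].
by apply/allpairsP; exists (a, w); rewrite /= mem_index_iota aK IH.
Qed.

Lemma sum_words (F : nat -> R) K m :
  \sum_(w <- words K m) \prod_(a <- w) F a = (\sum_(0 <= a < K) F a) ^+ m.
Proof.
elim: m => [|m IH] /=; first by rewrite big_seq1 big_nil.
rewrite big_allpairs_dep exprS -IH big_distrl /=; apply: eq_bigr => a _.
by rewrite big_distrr /=; apply: eq_bigr => w _; rewrite big_cons.
Qed.

Lemma size_words K m w : w \in words K m -> size w = m.
Proof.
elim: m w => [|m IH] w /=; first by rewrite inE => /eqP ->.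
by case/allpairsP => -[a v] /= [_ /IH vm ->] /=; rewrite vm.
Qed.

Lemma ler_sum_sub_seq (T : eqType) (S S' : seq T) (G : T -> R) :
  (forall x, 0 <= G x) -> uniq S -> {subset S <= S'} ->
  \sum_(x <- S) G x <= \sum_(x <- S') G x.
Proof.
move=> G0; elim: S S' => [|x S IH] S' /=.
  by move=> _ _; rewrite big_nil sumr_ge0.
move=> /andP[xS uS] sub; have xS' : x \in S' by apply: sub; rewrite inE eqxx.
rewrite big_cons (perm_big _ (perm_to_rem xS')) big_cons lerD2l IH //.
move=> y yS; have yS' : y \in S' by apply: sub; rewrite inE yS orbT.
have yx : y != x by apply: contraNneq xS => <-.
by move: yS'; rewrite (perm_mem (perm_to_rem xS')) inE (negbTE yx).
Qed.

(** The finite family [S] sits inside all words with letters below some [K] and lengths from N to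
    some L. Words of length m contribute (sum of F)^m g_m <= Z^m g_m <= 2^-m, and the geometric tail
    is at most 2 * 2^-N. *)
Lemma sum_word_weights_le (F g : nat -> R) (Z : R) (N : nat) (S : seq (seq nat)) :
  (forall a, 0 <= F a) -> (forall m, 0 <= g m) ->
  (forall K, \sum_(0 <= a < K) F a <= Z) ->
  (forall m, (N <= m)%N -> Z ^+ m * g m <= 2^-1 ^+ m) ->
  uniq S -> (forall w, w \in S -> (N <= size w)%N) ->
  \sum_(w <- S) (\prod_(a <- w) F a) * g (size w) <= 2 * 2^-1 ^+ N.
Proof.
move=> F0 g0 FZ ZN uS SN.
have Z0 : 0 <= Z by have := FZ 0%N; rewrite big_geq.
pose K := (\max_(w <- S) \max_(a <- w) a).+1.
pose L := \max_(w <- S) size w.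
pose T := [seq w | m <- index_iota N L.+1, w <- words K m].
have prod0 w : 0 <= \prod_(a <- w) F a by apply: prodr_ge0.
apply: (@le_trans _ _ (\sum_(w <- T) (\prod_(a <- w) F a) * g (size w))).
  apply: ler_sum_sub_seq => // [w|w wS]; first by rewrite mulr_ge0.
  apply/allpairsPdep; exists (size w), w; split => //.
    by rewrite mem_index_iota SN //= ltnS /L (big_rem w) //= leq_maxl.
  apply: mem_words; apply/allP => a aw; rewrite /K ltnS (big_rem w) //=.
  by rewrite (leq_trans _ (leq_maxl _ _)) // (big_rem a) //= leq_maxl.
rewrite /T big_allpairs_dep /=.
apply: (@le_trans _ _ (\sum_(N <= m < L.+1) 2^-1 ^+ m)).
  rewrite !big_nat; apply: ler_sum => m /andP[Nm _].
  apply: le_trans (ZN m Nm).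
  rewrite big_seq (eq_bigr (fun w => (\prod_(a <- w) F a) * g m)); last first.
    by move=> w /size_words ->.
  rewrite -big_seq -big_distrl /= sum_words ler_wpM2r //.
  by rewrite lerXn2r ?nnegrE ?sumr_ge0.
have H n : \sum_(N <= m < N + n) 2^-1 ^+ m = 2 * 2^-1 ^+ N - 2 * 2^-1 ^+ (N + n) :> R.
  elim: n => [|n IH]; first by rewrite addn0 big_geq // subrr.
  rewrite addnS big_nat_recr ?leq_addr //= IH exprS; lra.
have [h|h] := leqP N L.+1; last first.
  by rewrite [leLHS]big_geq ?mulr_ge0 ?exprn_ge0 ?invr_ge0 // ltnW.
rewrite -(subnKC h) H gerBl mulr_ge0 ?exprn_ge0 ?invr_ge0 //.
Qed.

End word_sums.

Section upper_bound.
Variable R : realType.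
Implicit Types (x y beta s tau : R) (w : seq nat).

Definition digit_prod n x : R := \prod_(1 <= i < n.+1) (pq i x)%:R.

(** A letter [a] stands for the partial quotient a + 1, so that every sequence of naturals is an
    admissible word. *)
Definition word_prod w : R := \prod_(a <- w) a.+1%:R.

Lemma word_prod_gt0 w : 0 < word_prod w.
Proof. by apply: prodr_gt0 => a _; rewrite ltr0n. Qed.

Lemma word_prod_ge1 w : 1 <= word_prod w.
Proof.
rewrite /word_prod; apply: (big_ind (fun y : R => 1 <= y)) => // [y z y1 z1|a _].
  by rewrite mulr_ege1.
by rewrite ler1n.
Qed.

Lemma digit_prod_word w x :
  (forall i, (i < size w)%N -> pq i.+1 x = (nth 0%N w i).+1) ->
  digit_prod (size w) x = word_prod w.
Proof.
move=> H; rewrite /digit_prod /word_prod big_add1 /= [RHS](big_nth 0%N).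
by rewrite big_nat [RHS]big_nat; apply: eq_bigr => i /andP[_ iw]; rewrite H.
Qed.

Lemma prod_zeta_term t w :
  \prod_(a <- w) zeta_term t a = expR (- (1 + t) * ln (word_prod w)).
Proof.
elim: w => [|a w IH]; first by rewrite /word_prod !big_nil ln1 mulr0 expR0.
rewrite /word_prod !big_cons IH lnM ?posrE ?word_prod_gt0 ?ltr0n //.
by rewrite mulrDr expRD.
Qed.

(** The last clause forces a large partial quotient right after [w], in the form delivered by
    [growth_dichotomy]. *)
Definition cylinder beta w : set R := [set x |
  [/\ irrational x, 0 < x < 1,
      forall i, (i < size w)%N -> pq i.+1 x = (nth 0%N w i).+1 &
      beta * Num.max (ln (word_prod w)) (beta ^+ size w) <=
        ln (digit_prod (size w).+1 x)]].

(** The next quotient is at least exp(beta v - q), so the tails are at most exp(q - beta v); the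
    branches along [w] contract by exp(-2q). *)
Lemma diam_cylinder beta w :
  (diam (cylinder beta w) <=
    (expR (- (beta * Num.max (ln (word_prod w)) (beta ^+ size w)) -
           ln (word_prod w)))%:E)%E.
Proof.
set v := Num.max _ _; set q := ln _.
have rest x : cylinder beta w x -> iter (size w) (@gauss R) x <= expR (q - beta * v).
  case=> ix x01 dx le.
  have [ig g01] := iter_gauss_itv (size w) ix x01.
  apply: le_trans (le_inv_pq1 g01) _.
  have a0 : 0 < (pq (size w).+1 x)%:R :> R by rewrite ltr0n pq_gt0.
  have -> : pq 1 (iter (size w) (@gauss R) x) = pq (size w).+1 x by [].
  move: le; rewrite /digit_prod big_nat_recr //= -/(digit_prod _ _) digit_prod_word //.
  rewrite lnM ?posrE ?word_prod_gt0 // -/v -/q => le.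
  rewrite -[X in X^-1](lnK (x := (pq (size w).+1 x)%:R)) ?posrE // -expRN ler_expR.
  by lra.
apply: diam_le; first exact: expR_ge0.
move=> x y Ux Uy; have [ix x01 dx _] := Ux; have [iy y01 dy _] := Uy.
apply: le_trans (dist_same_digits ix x01 iy y01 dx dy (rest x Ux) (rest y Uy)) _.
rewrite prodfV prodrXl -/(word_prod w).
rewrite -[word_prod w]lnK ?posrE ?word_prod_gt0 // -/q expr2 -expRD -expRN -expRD.
by rewrite ler_expR; lra.
Qed.

(** Split s beta v = (s beta - tau) v + tau v and use v >= q in the first part, v >= beta^m in the
    second. Adding s q, the coefficient of q becomes 1 + tau. *)
Lemma diam_pow_cylinder beta s tau w : 1 < beta -> 0 < s -> 0 < tau ->
  s * (beta + 1) = 1 + 2 * tau ->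
  (diam_pow s (cylinder beta w) <=
    (\prod_(a <- w) zeta_term tau a * expR (- tau * beta ^+ size w))%:E)%E.
Proof.
move=> be1 s0 t0 E.
apply: le_trans (diam_pow_le (ltW s0) (expR_ge0 _) (diam_cylinder beta w)) _.
rewrite -expRM prod_zeta_term -expRD lee_fin ler_expR.
set v := Num.max _ _; set q := ln _; set B := beta ^+ _.
have vq : q <= v by rewrite le_max lexx.
have vB : B <= v by rewrite le_max lexx orbT.
have st : 0 <= s * beta - tau by nra.
have := ler_wpM2l st vq; have := ler_wpM2l (ltW t0) vB.
have -> : (1 + tau) = s * beta + s - tau by lra.
lra.
Qed.

(** With r the square root of beta, one factor r^m is at least m (r - 1) by Bernoulli and the other
    eventually exceeds |k| / (r - 1). *)
Lemma expr_dominates_linear (beta k : R) : 1 < beta ->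
  exists N, forall m, (N <= m)%N -> m%:R * k <= beta ^+ m.
Proof.
move=> be1; pose r := Num.sqrt beta.
have be0 : 0 <= beta by lra.
have r1 : 1 < r by rewrite /r -[ltLHS]sqrtr1 ltr_sqrt //; lra.
have [N NP] := expr_unbounded r1 (`|k| / (r - 1)); exists N => m /NP.
have rp : 0 < r - 1 by lra.
rewrite ler_pdivrMr // => h.
have -> : beta ^+ m = r ^+ m * r ^+ m by rewrite -exprMn -expr2 sqr_sqrtr.
have h2 := bernoulli_le m r1.
have rm : 0 <= r ^+ m by rewrite exprn_ge0 //; lra.
apply: (@le_trans _ _ (m%:R * (r ^+ m * (r - 1)))).
  by rewrite ler_wpM2l // (le_trans (ler_norm k)).
rewrite mulrCA ler_wpM2l //; lra.
Qed.

(** Since a' <= a and all partial quotients are at least 1, [prodq l n x] is at most the product of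
    the first n + l - 1 quotients. Its logarithm thus satisfies the hypothesis of [growth_dichotomy]
    with k = ln c and shift l - 1. *)
Lemma Ell1_sub_cylinders (b c beta : R) (l N : nat) x :
  1 < beta -> beta < b -> 1 < c -> (0 < l)%N -> Ell1 b c l x ->
  exists2 w, (N <= size w)%N & cylinder beta w x.
Proof.
move=> be1 beb c1 l0 [/andP[x0 x1] [ix io]].
have x01 : 0 < x < 1 by rewrite lt_neqAle eq_sym irrational_neq0 // x0 x1.
have a1 i : (0 < i)%N -> (1 <= pq i x)%N by case: i => // i _; apply: pq_gt0.
have dle n : (0 < n)%N -> prodq l n x <= digit_prod (n + l.-1) x.
  move=> n0; rewrite /digit_prod -addnS prednK // (big_cat_nat (n := n)) ?leq_addr //=.
  rewrite -[leLHS]mul1r; apply: ler_pM => //.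
  - by apply: prodr_ge0.
  - rewrite big_nat; apply: (big_ind (fun y : R => 1 <= y)) => [//|y z y1 z1|i /andP[i0 _]].
      by rewrite mulr_ege1.
    by rewrite ler1n a1.
  - by apply: ler_prod => i _; rewrite ler0n ler_nat /pq' /=; case: ifP.
have [M|m Nm le] := @growth_dichotomy R (fun m => ln (digit_prod m x)) beta b
    (ln c) l.-1 be1 beb (ln_gt0 c1) _ N.
  have [n [Mn le]] := io M; exists n => //.
  have p0 : 0 < phi b c n by rewrite powR_gt0 //; lra.
  rewrite -ln_phi ler_ln ?posrE // ?(le_trans le) ?dle ?(leq_ltn_trans _ Mn) //.
  by rewrite (lt_le_trans p0) // (le_trans le) // dle // (leq_ltn_trans _ Mn).
pose w := mkseq (fun i => (pq i.+1 x).-1) m.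
have sw : size w = m by rewrite size_mkseq.
have dw i : (i < size w)%N -> pq i.+1 x = (nth 0%N w i).+1.
  by rewrite sw => im; rewrite nth_mkseq // prednK // a1.
exists w; first by rewrite sw.
by split => //; rewrite -(digit_prod_word dw) sw.
Qed.

Lemma hmeasure_Ell1_eq0 (b c s : R) (l : nat) : 1 < b -> 1 < c -> (0 < l)%N ->
  0 <= s -> 1 < s * (b + 1) -> hmeasure s (Ell1 b c l) = 0%E.
Proof.
move=> b1 c1 l0 s0 sb.
have sp : 0 < s by rewrite lt_neqAle s0 andbT; apply/eqP => s00; move: sb; rewrite -s00; lra.
(* Taking [beta] strictly between max(1, 1/s - 1) and b ensures 1 < beta < b and s (beta + 1) > 1,
   so that [tau] is positive. *)
pose b0 := Num.max 1 (s^-1 - 1); pose beta := (b0 + b) / 2.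
have b0b : b0 < b.
  by rewrite gt_max b1 /= ltrBlDr -[_^-1]mul1r ltr_pdivrMr // mulrC.
have be1 : 1 < beta.
  have : 1 <= b0 by rewrite le_max lexx.
  by rewrite /beta; lra.
have beb : beta < b by rewrite /beta; lra.
pose tau := (s * (beta + 1) - 1) / 2.
have t0 : 0 < tau.
  have : s^-1 - 1 <= b0 by rewrite le_max lexx orbT.
  move=> h; have : s^-1 < beta + 1 by rewrite /beta; lra.
  by rewrite -[_^-1]mul1r ltr_pdivrMr // mulrC /tau; lra.
have tE : s * (beta + 1) = 1 + 2 * tau by rewrite /tau; field.
pose Z := 1 + tau^-1.
have Z1 : 0 < Z by rewrite /Z addr_gt0 // invr_gt0.
pose g (m : nat) := expR (- tau * beta ^+ m).
apply/eqP; rewrite eq_le hmeasure_ge0 andbT.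
apply: ge_ereal_sup => _ [delta /= d0 <-].
apply/lee_addgt0Pr => e e0; rewrite add0e.
(* Three thresholds on the word length: [N1] makes Z^m g_m at most 2^-m, [N2] makes the diameters at
   most delta, and [N3] makes the total 2 * 2^-N less than e. *)
have [N1 H1] := expr_dominates_linear (ln (2 * Z) / tau) be1.
have [N2 H2] := expr_unbounded be1 (- ln delta).
have e20 : 0 < e / 2 by rewrite divr_gt0.
have [N3 _ H3] := near_infty_natSinv_expn_lt (PosNum e20).
pose N := maxn N1 (maxn N2 N3).
have NP m : (N <= m)%N -> [/\ (N1 <= m)%N, (N2 <= m)%N & (N3 <= m)%N].
  by rewrite !geq_max => /and3P[].
have HZ m : (N <= m)%N -> Z ^+ m * g m <= 2^-1 ^+ m.
  case/NP => /H1 h _ _; rewrite exprVn -[leRHS]mul1r ler_pdivlMr ?exprn_gt0 //.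
  rewrite mulrC mulrA -exprMn.
  have Z2 : 0 < 2 * Z by rewrite mulr_gt0.
  rewrite -[2 * Z]lnK ?posrE // -expRM_natl -expRD -[leRHS]expR0 ler_expR mulNr.
  move: h; rewrite mulrA ler_pdivrMr // [beta ^+ m * tau]mulrC; lra.
(* Words are enumerated by [pickle]; indices coding no word, or one that is too short, receive the
   empty set, which contributes 0. *)
pose U i : set R := if @pickle_inv (seq nat) i is Some w then
  if (N <= size w)%N then cylinder beta w else set0 else set0.
pose G w := (\prod_(a <- w) zeta_term tau a) * g (size w).
pose H w := if (N <= size w)%N then G w else 0.
have z0 a : 0 <= zeta_term tau a by apply: expR_ge0.
have g0 m : 0 <= g m by apply: expR_ge0.
have diam0 : (diam (@set0 R) <= delta%:E)%E by apply: diam_le => //; exact: ltW.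
apply: (@le_trans _ _ (\sum_(i <oo) diam_pow s (U i))%E).
  apply: ereal_inf_lbound; exists U => //; split.
    move=> x /(Ell1_sub_cylinders N be1 beb c1 l0)[w Nw wx].
    by exists (pickle w) => //; rewrite /U pickleK_inv Nw.
  move=> i; rewrite /U; case: (pickle_inv i) => [w|] //; case: ifP => // Nw.
  apply: le_trans (diam_cylinder beta w) _; rewrite lee_fin -[leRHS]lnK ?posrE //.
  rewrite ler_expR; have [_ /H2 h _] := NP _ Nw.
  have q0 : 0 <= ln (word_prod w) by rewrite ln_ge0 // word_prod_ge1.
  set v := Num.max _ _; have vB : beta ^+ size w <= v by rewrite le_max lexx orbT.
  have B0 : 0 <= beta ^+ size w by rewrite exprn_ge0 //; lra.
  by nra.
have UH i : (diam_pow s (U i) <= (oapp H 0 (@pickle_inv (seq nat) i))%:E)%E.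
  have dp0 : diam_pow s (@set0 R) = 0%E by rewrite /diam_pow eqxx.
  rewrite /U /H; case: (pickle_inv i) => [w|] /=; last by rewrite dp0.
  by case: ifP => _; [exact: diam_pow_cylinder|rewrite dp0].
apply: lime_le; first by apply: is_cvg_nneseries => i _ _; apply: diam_pow_ge0.
apply: nearW => n.
apply: (@le_trans _ _ (\sum_(0 <= i < n) (oapp H 0 (@pickle_inv (seq nat) i))%:E)%E).
  exact: lee_sum.
(* A partial sum over indices becomes a sum over a finite duplicate-free list of words of length at
   least N. *)
rewrite sumEFin lee_fin -big_pmap /H -big_mkcond -big_filter.
apply: (@le_trans _ _ (2 * 2^-1 ^+ N)).
  apply: (sum_word_weights_le z0 g0 (fun K => zeta_sum_le K t0) HZ).
    by rewrite filter_uniq // (pmap_uniq (@pickle_invK _)) // iota_uniq.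
  by move=> w; rewrite mem_filter => /andP[].
have [_ _ N3N] := NP N (leqnn N).
by have := H3 N N3N; rewrite /= div1r exprVn => h; lra.
Qed.

End upper_bound.

(** * The dimension formula *)

Unset Implicit Arguments.

Theorem theorem1p11 (R : realType) (b c : R) (l : nat) :
  1 < b -> 1 < c -> (1 <= l)%N ->
  dimH (Ell2 b c l) = ((b + 1)^-1)%:E /\ dimH (Ell1 b c l) = ((b + 1)^-1)%:E.
Proof.
move=> b1 c1 l0; have bp : 0 < b + 1 by lra.
have sub : Ell2 b c l `<=` Ell1 b c l.
  move=> x [/andP[x0 x1] [ix H]]; split; last first.
    by split => // N; exists N.+1; split => //; apply: H.
  rewrite x0 lt_neqAle x1 andbT; apply/eqP => xE; apply ix.
  by exists 1; rewrite xE rmorph1.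
have up : (dimH (Ell1 b c l) <= ((b + 1)^-1)%:E)%E.
  (* Every s = 1 / (b + 1) + e satisfies s (b + 1) > 1, so it is admissible in the infimum. *)
  apply/lee_addgt0Pr => e e0; apply: ereal_inf_lbound; exists ((b + 1)^-1 + e) => //.
  have s0 : 0 <= (b + 1)^-1 + e by rewrite addr_ge0 ?ltW // invr_gt0.
  split => //; apply: hmeasure_Ell1_eq0 => //.
  by rewrite mulrDl mulVf ?lt0r_neq0 // ltrDl mulr_gt0.
have lo : (((b + 1)^-1)%:E <= dimH (Ell2 b c l))%E.
  apply: le_ereal_inf_tmp => _ [s [s0 hs] <-]; rewrite lee_fin leNgt; apply/negP => lt.
  apply: (hmeasure_Ell2_neq0 b1 c1 l0 s0) hs.
  by rewrite -ltr_pdivlMr // mul1r.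
have mono : (dimH (Ell2 b c l) <= dimH (Ell1 b c l))%E.
  apply: ereal_inf_le_tmp => _ [s [s0 hs] <-]; exists s => //; split => //.
  by apply/eqP; rewrite eq_le hmeasure_ge0 andbT -hs hmeasure_le.
by split; apply/eqP; rewrite eq_le ?up ?lo ?(le_trans mono up) ?(le_trans lo mono).
Qed.
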